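(* Let $X$ be a complex Banach space of dimension at least $2$. Every atomic Boolean subspace lattice $\mathfrak{B}$ in $X$ is strongly reflexive, that is, $N_*=N$ for every $N\in\mathfrak{B}$; in particular, $\mathfrak{B}=\operatorname{Lat}\bigl(\operatorname{Rk}_1(\operatorname{Alg}(\mathfrak{B}))\bigr)$.
   Context: A subspace of $X$ means a closed linear subspace; $\mathfrak{C}(X)$ is the family of all subspaces of $X$. Joins and meets: $\bigvee_j M_j$ is the closed linear span of the $M_j$ (so $M\vee N=\overline{M+N}$), $\bigwedge_j M_j=\bigcap_j M_j$, with $\bigvee\emptyset=\{0\}$ and $\bigwedge\emptyset=X$. A subspace lattice in $X$ is a family $\mathfrak{L}\subseteq\mathfrak{C}(X)$ containing $\{0\}$ and $X$ and closed under arbitrary joins and meets. A subspace lattice is Boolean if it is distributive (both finite distributive laws hold for $\vee,\wedge$) and complemented (for each $M\in\mathfrak{L}$ there is $M'\in\mathfrak{L}$ with $M\wedge M'=\{0\}$, $M\vee M'=X$). An atom of $\mathfrak{L}$ is an element $K\in\mathfrak{L}$ with $\{0\}\ne K\ne X$ such that any $M\in\mathfrak{L}$ with $M\subseteq K$ is $\{0\}$ or $K$. $\mathfrak{L}$ is atomic if every $M\in\mathfrak{L}$ is the join of the atoms contained in $M$. For a subspace lattice $\mathfrak{L}$ and $M,N\in\mathfrak{C}(X)$, put $M_{-}=\bigvee\{K\in\mathfrak{L}: M\not\subseteq K\}$ and $N_{*}=\bigwedge\{M_{-}: M\in\mathfrak{L},\ M\not\subseteq N\}$ (here with $\mathfrak{L}=\mathfrak{B}$).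 $\mathfrak{L}$ is strongly reflexive if $N_*=N$ for all $N\in\mathfrak{L}$. $\mathcal{B}(X)$ is the algebra of bounded linear operators on $X$; $\operatorname{Alg}(\mathfrak{F})=\{A\in\mathcal{B}(X): AM\subseteq M\text{ for all }M\in\mathfrak{F}\}$; $\operatorname{Rk}_1(\mathcal{A})$ is the set of all rank-one operators in $\mathcal{A}$; $\operatorname{Lat}(\mathcal{T})=\{M\in\mathfrak{C}(X): TM\subseteq M\text{ for all }T\in\mathcal{T}\}$. *)

(* Defs.v *)
From HB Require Import structures.
From mathcomp Require Import all_boot all_order all_algebra.
From mathcomp Require Import complex.
From mathcomp Require Import all_classical all_reals all_analysis.

Set Implicit Arguments.
Unset Strict Implicit.
Unset Printing Implicit Defensive.

Import Order.TTheory GRing.Theory Num.Theory.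
Import numFieldNormedType.Exports.

Local Open Scope classical_set_scope.
Local Open Scope ring_scope.

Section Subspaces.
Context {K : numFieldType} {X : normedModType K}.
Implicit Types (M N : set X) (F L : set (set X)).

Definition closed_subspace M : Prop :=
  submod_closed (fun x : X => x \in M) /\ closed M.

Definition lin_span (S : set X) : set X :=
  [set x | exists n (c : 'I_n -> K) (v : 'I_n -> X),
     (forall i, S (v i)) /\ x = \sum_(i < n) c i *: v i].

(* On the empty family of closed subspaces, join and meet give [set 0] and
   setT. *)
Definition join F : set X := closure (lin_span (\bigcup_(M in F) M)).

Definition meet F : set X := \bigcap_(M in F) M.

Definition join2 M N : set X := join [set M; N].

Definition meet2 M N : set X := meet [set M; N].

Definition subspace_lattice L : Prop :=
  [/\ L `<=` closed_subspace,
      L [set 0],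
      L setT,
      forall F, F `<=` L -> L (join F) &
      forall F, F `<=` L -> L (meet F)].

Definition distributive_family L : Prop :=
  forall M N P, L M -> L N -> L P ->
    meet2 M (join2 N P) = join2 (meet2 M N) (meet2 M P) /\
    join2 M (meet2 N P) = meet2 (join2 M N) (join2 M P).

Definition complemented_family L : Prop :=
  forall M, L M ->
    exists M', [/\ L M', meet2 M M' = [set 0] & join2 M M' = setT].

Definition Boolean_lattice L : Prop :=
  [/\ subspace_lattice L, distributive_family L & complemented_family L].

(* The whole space is never an atom, even when it is minimal among the nonzero
   members of L. *)
Definition atom L M : Prop :=
  [/\ L M, M <> [set 0], M <> setT &
      forall N, L N -> N `<=` M -> N = [set 0] \/ N = M].

Definition atomic L : Prop :=
  forall M, L M -> M = join [set A | atom L A /\ A `<=` M].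

Definition lower_minus L M : set X := join [set N | L N /\ ~ (M `<=` N)].

Definition lower_star L N : set X :=
  meet [set lower_minus L M | M in [set M | L M /\ ~ (M `<=` N)]].

Definition strongly_reflexive L : Prop :=
  forall N, L N -> lower_star L N = N.

Definition bounded_operator (A : {linear X -> X}) : Prop :=
  bounded_near A (nbhs (0 : X)).

Definition Alg F : set {linear X -> X} :=
  [set A | bounded_operator A /\ forall M, F M -> A @` M `<=` M].

Definition rank_one (A : {linear X -> X}) : Prop :=
  exists2 y : X, y != 0 & range A = [set c *: y | c in [set: K]].

Definition Rk1 (T : set {linear X -> X}) : set {linear X -> X} :=
  [set A | T A /\ rank_one A].

Definition Lat (T : set {linear X -> X}) : set (set X) :=
  [set M | closed_subspace M /\ forall A, T A -> A @` M `<=` M].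

Definition dim_ge2 : Prop :=
  exists x y : X, forall a b : K, a *: x + b *: y = 0 -> a = 0 /\ b = 0.

End Subspaces.

Arguments dim_ge2 {K} X.

(* Main.v *)
(* Let M be an atom with complement M'. Distributivity gives, for N in B,
   either M <= N or N <= M', so M_- = M'; hence an atom below N_* but not below
   N would lie below its own complement, and N_* = N by atomicity.
   For N in Lat (Rk1 (Alg B)) the same dichotomy holds: if N is not below M',
   a functional f vanishing on M' but not on N gives, for each e in M, the
   operator f(.)e in Alg B, which forces e into N. Hence the join of the atoms
   below N and the meet of the members of B above N contain the same atoms, so
   they coincide, with N squeezed in between.
   The functional comes from Hahn-Banach, proved by minimizing sublinear
   functionals: infimal convolution with a cone makes a sublinear functional
   smaller, and a minimal one is linear. *)
Require Import Defs.
From HB Require Import structures.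
From mathcomp Require Import all_boot all_order all_algebra.
From mathcomp Require Import complex ring lra.
From mathcomp Require Import all_classical all_reals all_analysis.

Set Implicit Arguments.
Unset Strict Implicit.
Unset Printing Implicit Defensive.

Import Order.TTheory GRing.Theory Num.Theory.
Import numFieldNormedType.Exports.
Local Open Scope classical_set_scope.
Local Open Scope ring_scope.

(** * Real Hahn-Banach theorem in Mazur-Orlicz form *)

Section MazurOrlicz.
Context {R : realType} {V : lmodType R}.
Implicit Types (p q : V -> R) (C : set (V * R)).

(* The inequality in the second clause is an equality for [t > 0], by applying
   it to [t^-1], and for [t = 0], by the first clause. *)
Definition sublinear p : Prop :=
  (forall x y, p (x + y) <= p x + p y) /\
  (forall (t : R) x, 0 <= t -> p (t *: x) <= t * p x).

(** A pair [(v, r)] in [C] encodes the constraint [r <= q v] on the functional [q] to be found. *)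
Definition convex_cone C : Prop :=
  [/\ C (0, 0),
      forall a b, C a -> C b -> C (a.1 + b.1, a.2 + b.2) &
      forall (t : R) a, 0 <= t -> C a -> C (t *: a.1, t * a.2)].

(** A linear [q] below [p] meeting the constraints has [q x = q (x + v) - q v <= p (x + v) - r] for
    each [(v, r)] in [C]; this is the resulting upper bound on [q x]. *)
Definition inf_conv p C (x : V) : R := inf [set p (x + a.1) - a.2 | a in C].

Lemma sublinear0 p : sublinear p -> p 0 = 0.
Proof.
move=> [pD pZ]; apply/le_anti/andP; split.
  by have := pZ 0 0 (lexx 0); rewrite scale0r mul0r.
by have := pD 0 0; rewrite addr0; lra.
Qed.

Lemma sublinear_ge_oppN p x : sublinear p -> - p (- x) <= p x.
Proof.
by move=> sp; have := sp.1 x (- x); rewrite subrr (sublinear0 sp); lra.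
Qed.

(** The infimum is finite: [r <= p v <= p (x + v) + p (- x)] bounds it below by [- p (- x)]. Sums
    and positive multiples in [C] give sublinearity; the pair [(0, 0)] gives the bound by [p]. *)
Lemma sublinear_inf_conv p C : sublinear p -> convex_cone C ->
  (forall a, C a -> a.2 <= p a.1) ->
  [/\ sublinear (inf_conv p C), forall x, inf_conv p C x <= p x &
      forall a, C a -> inf_conv p C (- a.1) <= - a.2].
Proof.
move=> sp [C0 CD CZ] Cp; have p0 := sublinear0 sp; have [pD pZ] := sp.
have lb x : has_lbound [set p (x + a.1) - a.2 | a in C].
  exists (- p (- x)) => _ [a Ca <-].
  by have := pD (x + a.1) (- x); rewrite addrAC subrr add0r; have := Cp a Ca; lra.
have le_conv x a : C a -> inf_conv p C x <= p (x + a.1) - a.2.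
  by move=> Ca; apply: ge_inf => //; exists a.
have ge_conv x (r : R) :
    (forall a, C a -> r <= p (x + a.1) - a.2) -> r <= inf_conv p C x.
  move=> rC; apply: lb_le_inf; first by exists (p (x + 0) - 0); exists (0, 0).
  by move=> _ [a Ca <-]; apply: rC.
have conv_le x : inf_conv p C x <= p x.
  by have := le_conv x _ C0; rewrite addr0 subr0.
split=> //; last first.
  by move=> a Ca; have := le_conv (- a.1) a Ca; rewrite addNr p0 sub0r.
split=> [x y|t x].
  rewrite -lerBlDr; apply: (ge_conv _) => a Ca.
  rewrite lerBlDr [leRHS]addrC -lerBlDr; apply: (ge_conv _) => b Cb.
  have := le_conv (x + y) _ (CD a b Ca Cb); rewrite /= addrACA.
  by have := pD (x + a.1) (y + b.1); lra.
rewrite le0r => /predU1P[->|t0].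
  by rewrite scale0r mul0r -p0.
rewrite -ler_pdivrMl//; apply: (ge_conv _) => a Ca; rewrite ler_pdivrMl//.
apply: (le_trans (le_conv _ _ (CZ t a (ltW t0) Ca))) => /=.
by rewrite -scalerDr mulrBr lerB// pZ// ltW.
Qed.

(** Given two members of the chain, the smaller one serves at both points, whence subadditivity. The
    bound [- p (- x)] keeps the infimum finite. *)
Lemma sublinear_chain_inf p (A : set (V -> R)) :
  A !=set0 -> A `<=` [set q | sublinear q /\ forall x, q x <= p x] ->
  (forall q r, A q -> A r -> (forall x, q x <= r x) \/ (forall x, r x <= q x)) ->
  sublinear (fun x => inf [set q x | q in A]) /\
  forall q x, A q -> inf [set q x | q in A] <= q x.
Proof.
move=> [q0 Aq0] Asub Atot.
have lb x : has_lbound [set q x | q in A].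
  exists (- p (- x)) => _ [q Aq <-]; have [sq qp] := Asub q Aq.
  by apply: le_trans (sublinear_ge_oppN x sq); rewrite lerN2.
have le_chain q x : A q -> inf [set q x | q in A] <= q x.
  by move=> Aq; apply: ge_inf => //; exists q.
have ge_chain x (r : R) : (forall q, A q -> r <= q x) -> r <= inf [set q x | q in A].
  move=> rA; apply: lb_le_inf; first by exists (q0 x); exists q0.
  by move=> _ [q Aq <-]; apply: rA.
split=> //; split=> [x y|t x].
  rewrite -lerBlDr; apply: (ge_chain _) => q Aq.
  rewrite lerBlDr [leRHS]addrC -lerBlDr; apply: (ge_chain _) => r Ar.
  have [qr|rq] := Atot q r Aq Ar.
    have := le_chain q (x + y) Aq; have := (Asub q Aq).1.1 x y.
    by have := qr y; lra.
  have := le_chain r (x + y) Ar; have := (Asub r Ar).1.1 x y.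
  by have := rq x; lra.
rewrite le0r => /predU1P[->|t0].
  by rewrite scale0r mul0r -(sublinear0 (Asub q0 Aq0).1) le_chain.
rewrite -ler_pdivrMl//; apply: (ge_chain _) => q Aq; rewrite ler_pdivrMl//.
by apply: le_trans ((Asub q Aq).1.2 t x (ltW t0)); apply: le_chain.
Qed.

Lemma minimal_sublinear_linear q : sublinear q ->
  (forall r, sublinear r -> (forall x, r x <= q x) -> r = q) -> scalar q.
Proof.
move=> sq qmin; have [qD qZ] := sq.
have addq x y : q (x + y) = q x + q y.
  (* Convolving with the ray through [(y, q y)] gives a functional that minimality identifies with
     [q], so [q (- y) <= - q y]. *)
  pose C : set (V * R) := [set a | exists2 t, 0 <= t & a = (t *: y, t * q y)].
  have coneC : convex_cone C.
    split; first by exists 0; rewrite // scale0r mul0r.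
      move=> _ _ [s s0 ->] [t t0 ->]; exists (s + t); first exact: addr_ge0.
      by rewrite /= scalerDl mulrDl.
    move=> t _ t0 [s s0 ->]; exists (t * s); first exact: mulr_ge0.
    by rewrite /= scalerA mulrA.
  have Cq a : C a -> a.2 <= q a.1.
    move=> [t + ->] /=; rewrite le0r => /predU1P[->|t0].
      by rewrite scale0r mul0r (sublinear0 sq).
    have := qZ t^-1 (t *: y); rewrite scalerA mulVf ?gt_eqF// scale1r.
    by rewrite invr_ge0 ltW// ler_pdivlMl// => /(_ isT).
  have [sc cle cC] := sublinear_inf_conv sq coneC Cq.
  have Cy : C (y, q y) by exists 1; rewrite // scale1r mul1r.
  have := cC _ Cy; rewrite (qmin _ sc cle) /= => qNy.
  by apply/le_anti/andP; split=> //; have := qD (x + y) (- y); rewrite addrK; lra.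
have q0 := sublinear0 sq.
have qN x : q (- x) = - q x.
  by apply/eqP; rewrite -subr_eq0 opprK -addq addNr q0.
have scq (t : R) x : 0 <= t -> q (t *: x) = t * q x.
  move=> t0; apply/le_anti/andP; split; first exact: qZ.
  by have := qZ t (- x) t0; rewrite scalerN !qN mulrN lerN2.
move=> t x y; rewrite addq; congr (_ + _).
have [t0|t0] := leP 0 t; first exact: scq.
rewrite -[t in LHS]opprK scaleNr qN scq ?oppr_ge0 ?ltW//.
by rewrite mulNr opprK.
Qed.

Lemma sublinear_ge_linear p : sublinear p ->
  exists2 q, scalar q & forall x, q x <= p x.
Proof.
move=> sp; pose P q := sublinear q /\ forall x, q x <= p x; pose T := {q | P q}.
(* The order is reversed: a maximal element for [le] is a pointwise minimal functional. *)
pose le (q r : T) := `[< forall x, sval r x <= sval q x >].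
have [| | |A Atot|[q [sq qp]] qmax] := @Zorn T le.
- by move=> q; apply/asboolP.
- move=> r s t /asboolP sr /asboolP ts; apply/asboolP => x.
  exact: le_trans (ts x) (sr x).
- move=> [s Ps] [t Pt] /asboolP /= st /asboolP /= ts; apply: eq_exist.
  by apply/funext => x; apply/le_anti; rewrite st ts.
- have [->|/set0P[q0 Aq0]] := eqVneq A set0.
    by exists (exist P p (conj sp (fun=> lexx _))).
  have [|_ [q Aq <-]|q r [s As <-] [t At <-]|si ile] :=
      @sublinear_chain_inf p [set sval q | q in A].
  + by exists (sval q0), q0.
  + exact: svalP.
  + by have [/asboolP|/asboolP] := Atot s t As At; [right|left].
  + have lep x : inf [set q x | q in [set sval q | q in A]] <= p x.
      by apply: le_trans ((svalP q0).2 x); apply: ile; exists q0.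
    exists (exist P _ (conj si lep)) => q Aq.
    by apply/asboolP => x; apply: ile; exists q.
exists q => //; apply: minimal_sublinear_linear => // r sr rq.
have rp x : r x <= p x by apply: le_trans (qp x).
by have /(congr1 sval) := qmax (exist P r (conj sr rp)) (asboolT rq).
Qed.

(** A linear [q] below [inf_conv p C] satisfies [- q v = q (- v) <= - r] for [(v, r)] in [C]. *)
Lemma sublinear_separation p C : sublinear p -> convex_cone C ->
  (forall a, C a -> a.2 <= p a.1) ->
  exists q, [/\ scalar q, forall x, q x <= p x & forall a, C a -> a.2 <= q a.1].
Proof.
move=> sp coneC Cp.
have [sc cp cC] := sublinear_inf_conv sp coneC Cp.
have [q lq qc] := sublinear_ge_linear sc.
exists q; split=> // [x|a Ca]; first exact: le_trans (cp x).
have := le_trans (qc _) (cC a Ca).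
have q0 : q 0 = 0 by have := lq (-1) 0 0; rewrite scaler0 addr0 mulN1r addNr.
by have := lq (-1) a.1 0; rewrite addr0 scaleN1r q0; lra.
Qed.

End MazurOrlicz.

(** * Restriction of scalars to [R], under a separate type name so that both module structures
    coexist *)

Definition realified {R : realType} (X : lmodType R[i]) : Type := X.

Section Realified.
Context {R : realType} (X : lmodType R[i]).

HB.instance Definition _ := GRing.Zmodule.on (realified X).

Let scale (r : R) (x : realified X) : realified X := (r%:C)%C *: (x : X).

Let scaleA r s x : scale r (scale s x) = scale (r * s) x.
Proof. by rewrite /scale scalerA -rmorphM. Qed.

Let scale1 : left_id 1 scale.
Proof. by move=> x; rewrite /scale rmorph1 scale1r. Qed.

Let scaleDr : right_distributive scale +%R.
Proof. by move=> r x y; rewrite /scale scalerDr. Qed.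

Let scaleDl x : {morph scale^~ x : r s / r + s}.
Proof. by move=> r s; rewrite /scale rmorphD scalerDl. Qed.

HB.instance Definition _ := GRing.Zmodule_isLmodule.Build R (realified X)
  scaleA scale1 scaleDr scaleDl.

Lemma realified_scaleE (r : R) (x : realified X) : r *: x = (r%:C)%C *: (x : X).
Proof. by []. Qed.

End Realified.

(** * Separating a point from a closed complex subspace *)

Section ComplexSeparation.
Context {R : realType} {X : normedModType R[i]}.
Implicit Types (M : set X) (x y e : X).

Let nr x : R := complex.Re `|x|.

Let nrE x : `|x| = ((nr x)%:C)%C.
Proof.
by have := normr_ge0 x; rewrite lecE /nr; case: `|x| => a b /= /andP[/eqP-> _].
Qed.

Let nr_sublinear : @sublinear R (realified X) nr.
Proof.
split=> [x y|t x t0].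
  by rewrite -lecR rmorphD /= -!nrE; apply: ler_normD.
rewrite -lecR rmorphM /= -!nrE realified_scaleE normrZ.
by rewrite ger0_norm// lecR.
Qed.

Lemma closed_subspace0 M : closed_subspace M -> M 0.
Proof. by move=> [[/set_mem]]. Qed.

Lemma closed_subspaceDZ M (c : R[i]) x y :
  closed_subspace M -> M x -> M y -> M (c *: x + y).
Proof.
by move=> [[_ DZ] _] /mem_set Mx /mem_set My; apply/set_mem/DZ.
Qed.

Lemma closed_subspaceZ M (c : R[i]) x : closed_subspace M -> M x -> M (c *: x).
Proof.
move=> Mc Mx; rewrite -[c *: x]addr0.
by apply: closed_subspaceDZ => //; apply: closed_subspace0.
Qed.

Lemma closed_subspace_dist M x : closed_subspace M -> ~ M x ->
  exists2 d : R, 0 < d & forall m, M m -> (d%:C)%C <= `|x - m|.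
Proof.
move=> [_ Mcl] nMx; have /nbhs_ballP[e /= e0 eM] : nbhs x (~` M).
  by apply: open_nbhs_nbhs; split=> //; apply: closed_openC.
(* A positive element of [R[i]] has zero imaginary part. *)
have eE : e = ((complex.Re e)%:C)%C.
  by move: e0; rewrite ltcE; case: e {eM} => a b /= /andP[/eqP-> _].
exists (complex.Re e); first by rewrite -ltcR -eE.
move=> m Mm; rewrite -eE real_leNgt ?normr_real ?gtr0_real//.
by apply/negP => me; apply: (eM m) => //; rewrite -ball_normE.
Qed.

Lemma complex_separation M x : closed_subspace M -> ~ M x ->
  exists f : X -> R[i], [/\ scalar f, forall y, `|f y| <= 2 * `|y|,
    forall m, M m -> f m = 0 & f x != 0].
Proof.
move=> Mc nMx; have [d d0 dM] := closed_subspace_dist Mc nMx.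
(* Constraints [0 <= u m] on [M], which force [u = 0] there since [M] contains negatives, and
   [d <= u x]. *)
pose C : set (realified X * R) :=
  [set a | exists m t, [/\ M m, 0 <= t & a = (m + (t%:C)%C *: x, t * d)]].
have coneC : convex_cone C.
  split.
  - exists 0, 0; split=> //; first exact: closed_subspace0.
    by rewrite scale0r addr0 mul0r.
  - move=> _ _ [m [s [Mm s0 ->]]] [n [t [Mn t0 ->]]]; exists (m + n), (s + t).
    split; last by rewrite /= rmorphD scalerDl mulrDl addrACA.
      by rewrite -[m]scale1r; apply: closed_subspaceDZ.
    exact: addr_ge0.
  - move=> t _ t0 [m [s [Mm s0 ->]]]; exists ((t%:C)%C *: m), (t * s).
    split; [exact: closed_subspaceZ|exact: mulr_ge0|].
    by rewrite /= realified_scaleE scalerDr scalerA rmorphM mulrA.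
have Cnr a : C a -> a.2 <= nr a.1.
  move=> [m [t [Mm t0 ->]]] /=; rewrite -lecR -nrE rmorphM /=.
  have [->|tn0] := eqVneq t 0; first by rewrite mul0r.
  have tc : (t%:C)%C != 0 :> R[i] by rewrite fmorph_eq0.
  (* Factoring out [t] leaves [x] minus a point of [M], whose norm is at least [d]. *)
  have -> : m + (t%:C)%C *: x = (t%:C)%C *: (x - (- (t%:C)%C^-1) *: m).
    by rewrite scalerBr scalerA mulrN divff// scaleN1r opprK addrC.
  rewrite normrZ ger0_norm ?lecR// ler_wpM2l ?lecR//.
  by apply: dM; apply: closed_subspaceZ.
have [u [ul up uC]] := sublinear_separation nr_sublinear coneC Cnr.
have u0 : u 0 = 0 by have := ul (-1) 0 0; rewrite scaler0 addr0 mulN1r addNr.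
have uD y z : u (y + z) = u y + u z.
  by have := ul 1 y z; rewrite scale1r mul1r.
have uZ (r : R) y : u ((r%:C)%C *: y) = r * u y.
  by have := ul r y 0; rewrite !addr0 u0 addr0.
have uN y : u (- y) = - u y.
  by have := ul (-1) y 0; rewrite u0 !addr0 scaleN1r mulN1r.
have uM m : M m -> u m = 0.
  have uM_ge0 n : M n -> 0 <= u n.
    move=> Mn; apply: (uC (n, 0)); exists n, 0; split=> //.
    by rewrite scale0r addr0 mul0r.
  move=> Mm; apply/le_anti; rewrite uM_ge0// andbT -oppr_ge0 -uN.
  by apply: uM_ge0; rewrite -scaleN1r; apply: closed_subspaceZ.
have ux : 0 < u x.
  apply: (lt_le_trans d0); apply: (uC (x, d)); exists 0, 1; split=> //.
    exact: closed_subspace0.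
  by rewrite rmorph1 scale1r add0r mul1r.
(* The complex functional with real part [u]: the imaginary part is dictated by
   [f (i y) = i f y]. *)
pose f y : R[i] := (u y +i* - u ('i%C *: y))%C.
have fD y z : f (y + z) = f y + f z.
  by rewrite /f scalerDr !uD opprD.
have fR (r : R) y : f ((r%:C)%C *: y) = (r%:C)%C * f y.
  rewrite /f scalerA mulrC -scalerA !uZ.
  by apply/eqP; rewrite eq_complex /=; apply/andP; split; apply/eqP; ring.
have fi y : f ('i%C *: y) = 'i%C * f y.
  rewrite /f scalerA -expr2 sqr_i scaleN1r uN opprK.
  by apply/eqP; rewrite eq_complex /=; apply/andP; split; apply/eqP; ring.
have normi : `|'i%C| = 1 :> R[i].
  by rewrite normc_def /= expr0n expr1n add0r sqrtr1.
have normC (r : R) : `|(r%:C)%C| = (`|r|%:C)%C :> R[i].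
  by rewrite normc_def /= expr0n addr0 sqrtr_sqr.
have u_le y : `|u y| <= nr y.
  rewrite ler_norml up andbT lerNl -uN.
  by have := up (- y); rewrite /nr normrN.
exists f; split.
- move=> c y z; rewrite fD; congr (_ + _).
  by rewrite [c]complexE scalerDl fD -scalerA fi !fR mulrDl mulrA.
(* Estimating the real and imaginary parts separately produces the factor 2. *)
- move=> y; have -> : f y = ((u y)%:C)%C - 'i%C * ((u ('i%C *: y))%:C)%C.
    by apply/eqP; rewrite eq_complex /=; apply/andP; split; apply/eqP; ring.
  apply: (le_trans (ler_normB _ _)); rewrite normrM normi mul1r.
  rewrite mulr_natl mulr2n lerD// !normC nrE lecR ?u_le//.
  by apply: (le_trans (u_le _)); rewrite -lecR -!nrE normrZ normi mul1r.
- by move=> m Mm; rewrite /f !uM ?oppr0//; apply: closed_subspaceZ.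
- by rewrite eq_complex /= negb_and gt_eqF.
Qed.

End ComplexSeparation.


(** * Rank-one operators from bounded functionals *)

Lemma rank_one_operator (K : numFieldType) (X : normedModType K)
    (f : X -> K) (c : K) (e : X) :
  scalar f -> (forall x, `|f x| <= c * `|x|) -> 0 <= c ->
  exists A : {linear X -> X},
    [/\ bounded_operator A, forall x, A x = f x *: e &
        forall x, f x != 0 -> e != 0 -> rank_one A].
Proof.
move=> fl fc c0.
have lA : linear (fun x => f x *: e).
  by move=> a x y; rewrite fl scalerDl scalerA.
pose A : {linear X -> X} :=
  HB.pack (fun x => f x *: e) (GRing.isLinear.Build K X X _ _ lA).
exists A; split=> //.
  (* Boundedness near 0 is checked on the unit ball, where [|f y| <= c]. *)
  apply/ex_bound; exists (c * `|e|); apply/nbhs_ballP; exists 1 => //= y.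
  rewrite -ball_normE /= sub0r normrN => y1; rewrite normrZ.
  apply: ler_wpM2r => //; apply: (le_trans (fc _)).
  by rewrite -[leRHS]mulr1 ler_wpM2l// ltW.
move=> x fx e0; exists e => //; apply/seteqP; split=> [_ [y _ <-]|_ [a _ <-]].
  by exists (f y).
have fZ : f ((a / f x) *: x) = a.
  have f0 : f 0 = 0 by have := fl (-1) 0 0; rewrite scaler0 addr0 mulN1r addNr.
  by have := fl (a / f x) x 0; rewrite !addr0 f0 addr0 divfK.
by exists ((a / f x) *: x); rewrite //= fZ.
Qed.

(** * Atoms, strong reflexivity and invariant subspaces *)

Section Lattice.
Context {R : realType} {X : normedModType R[i]}.
Implicit Types (M N P : set X) (B F : set (set X)).

Lemma join_sub F P : closed_subspace P -> (forall M, F M -> M `<=` P) ->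
  join F `<=` P.
Proof.
move=> Pc FP; rewrite /join closureE; apply: smallest_sub; first by case: Pc.
move=> _ [n [c [v [Fv ->]]]]; elim/big_rec: _ => [|i y _ Py].
  exact: closed_subspace0.
by apply: closed_subspaceDZ => //; have [M FM] := Fv i; apply: FP.
Qed.

Lemma sub_join F M : F M -> M `<=` join F.
Proof.
move=> FM x Mx; apply: subset_closure; exists 1, (fun=> 1), (fun=> x).
by split; [move=> _; exists M | rewrite big_ord1 scale1r].
Qed.

Lemma sub_meet2 M N P : P `<=` M -> P `<=` N -> P `<=` meet2 M N.
Proof. by move=> PM PN x Px Q [->|->]; [exact: PM | exact: PN]. Qed.

Lemma meet2_subl M N : meet2 M N `<=` M.
Proof. by move=> x; apply; left. Qed.

Lemma meet2_subr M N : meet2 M N `<=` N.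
Proof. by move=> x; apply; right. Qed.

(** By minimality [M] meets [N] in [M] or in 0. In the second case distributing [N] over the join of
    [M] and [M'] leaves only the meet of [N] and [M']. If [M] lay below [M'], it would be 0. *)
Lemma atom_complement B M : Boolean_lattice B -> atom B M ->
  exists M', [/\ B M', ~ M `<=` M' & forall N, B N -> M `<=` N \/ N `<=` M'].
Proof.
move=> [[Bc B0 BT Bj Bm] dB cB] [BM M0 MT Mmin].
have [M' [BM' MM'0 MM'T]] := cB M BM; exists M'; split=> // [MM'|N BN].
  apply: M0; apply/seteqP; split=> [x Mx|_ ->].
    by rewrite -MM'0; apply: sub_meet2 Mx.
  exact: closed_subspace0 (Bc _ BM).
have BMN : B (meet2 M N) by apply: Bm => _ [->|->].
have [MN0|MNM] := Mmin _ BMN (@meet2_subl _ _); last first.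
  by left; rewrite -MNM; apply: meet2_subr.
right; have [NE _] := dB N M M' BN BM BM'.
have NN : N `<=` meet2 N (join2 M M') by rewrite MM'T; apply: sub_meet2.
apply: (subset_trans NN); rewrite NE; apply: join_sub; first exact: Bc.
move=> _ [->|->]; last exact: meet2_subr.
move=> x Nx; have : meet2 M N x.
  by apply: sub_meet2 Nx; [exact: meet2_subr|exact: meet2_subl].
by rewrite MN0 => ->; exact: closed_subspace0 (Bc _ BM').
Qed.

(** Reduces an inclusion to atoms, whose join is [M]. *)
Lemma atomic_sub B M P : atomic B -> B M -> closed_subspace P ->
  (forall A, atom B A -> A `<=` M -> A `<=` P) -> M `<=` P.
Proof.
move=> aB BM Pc MP; rewrite (aB M BM).
by apply: join_sub => // A [? ?]; exact: MP.
Qed.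

Lemma atomic_Boolean_strongly_reflexive B :
  Boolean_lattice B -> atomic B -> strongly_reflexive B.
Proof.
move=> BB aB N BN; have [[Bc _ _ Bj Bm] _ _] := BB.
apply/seteqP; split; last first.
  (* [N] is itself among the members joined in [lower_minus B M], as [M] is not below [N]. *)
  by move=> x Nx _ [M [BM MN] <-]; apply: (sub_join (M := N)) Nx.
have BNs : B (lower_star B N).
  by apply: Bm => _ [M _ <-]; apply: Bj => P [].
apply: atomic_sub BNs _ _ => //; first exact: Bc.
move=> A atA AN; have [BA _ _ _] := atA.
have [A' [BA' AA' AN']] := atom_complement BB atA.
have [//|nAN] := pselect (A `<=` N).
exfalso; apply: AA'; apply: (subset_trans AN).
(* Each member not containing [A] lies below [A']; since [A] is not below [N], [lower_minus B A] is
   one of the terms of the meet [lower_star B N]. *)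
have Am : lower_minus B A `<=` A'.
  by apply: join_sub; [exact: Bc | move=> P [BP nAP]; have [] := AN' P BP].
by apply: subset_trans Am => x; apply; exists A.
Qed.

(** For [e] in [A] and [f] vanishing on [A'], the operator [f(.)e] maps into every member above [A]
    and kills every member below [A'], so it leaves all of [B] invariant. Applied to a point of [N]
    where [f] is nonzero, it puts [e] in [N]. *)
Lemma Lat_Rk1_Alg_atom B N A A' : Boolean_lattice B -> B A -> B A' ->
  (forall P, B P -> A `<=` P \/ P `<=` A') ->
  Lat (Rk1 (Alg B)) N -> A `<=` N \/ N `<=` A'.
Proof.
move=> [[Bc _ _ _ _] _ _] BA BA' AA' [Nc RN].
have [|/existsNP[x /not_implyP[Nx nA'x]]] := pselect (N `<=` A'); first by right.
left=> e Ae; have [->|e0] := eqVneq e 0; first exact: closed_subspace0.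
have [f [fl fb fA' fx]] := complex_separation (Bc _ BA') nA'x.
have [T [Tb TE Tr]] := rank_one_operator e fl fb (ler0n _ 2).
have TR : Rk1 (Alg B) T.
  split; last exact: Tr fx e0.
  split=> // P BP _ [y Py <-]; rewrite TE; have [AP|PA'] := AA' P BP.
    by apply: closed_subspaceZ; [exact: Bc|exact: AP].
  by rewrite fA' ?scale0r; [exact: closed_subspace0 (Bc _ BP)|exact: PA'].
have : N (T x) by apply: (RN T TR); exists x.
move=> /(closed_subspaceZ (f x)^-1 Nc).
by rewrite TE scalerA mulVf// scale1r.
Qed.

Lemma atomic_Boolean_Lat B : Boolean_lattice B -> atomic B ->
  B = Lat (Rk1 (Alg B)).
Proof.
move=> BB aB; have [[Bc _ _ Bj Bm] _ _] := BB.
apply/seteqP; split=> [N BN|N LN].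
  by split=> [|T [[_ TB] _]]; [exact: Bc|exact: TB].
have [Nc _] := LN.
pose S := [set A | atom B A /\ A `<=` N].
have BS : B (join S) by apply: Bj => A [[]].
pose U := [set P | B P /\ N `<=` P].
have BU : B (meet U) by apply: Bm => P [].
suff -> : N = join S by [].
apply/seteqP; split; last by apply: join_sub => // A [].
have NU : N `<=` meet U by move=> x Nx P [_]; apply.
apply: (subset_trans NU); apply: atomic_sub BU _ _ => //; first exact: Bc.
move=> A atA AU; have [BA _ _ _] := atA.
have [A' [BA' nAA' AA']] := atom_complement BB atA.
have [AN|NA'] := Lat_Rk1_Alg_atom BB BA BA' AA' LN; first exact: sub_join.
(* If [N] lay below [A'], then [A'] would belong to [U] and [A], being below [meet U], would lie
   below [A']. *)
by exfalso; apply: nAA'; apply: (subset_trans AU) => x; apply.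
Qed.

End Lattice.

Theorem theorem6 (R : realType) (X : completeNormedModType R[i])
  (dimX : dim_ge2 X) (B : set (set X))
  (Bboolean : Boolean_lattice B) (Batomic : atomic B) :
  strongly_reflexive B /\ B = Lat (Rk1 (Alg B)).
Proof.
split; first exact: atomic_Boolean_strongly_reflexive.
exact: atomic_Boolean_Lat.
Qed.
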